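(* For every $\theta\in(0,\frac{\pi}{3})$ and every $a\in\Delta_\theta$, $$\underline{d}_{\nu_\theta}(a)+\overline{\dim}_B E_{\theta,a}=s,\qquad \overline{d}_{\nu_\theta}(a)+\underline{\dim}_B E_{\theta,a}=s.$$
   Context: $\Delta\subset\mathbb{R}^2$ is the Sierpiński gasket: the unique non-empty compact set with $\Delta=S_0(\Delta)\cup S_1(\Delta)\cup S_2(\Delta)$, where $S_0(x,y)=(\frac x2,\frac y2)$, $S_1(x,y)=(\frac x2+\frac12,\frac y2)$, $S_2(x,y)=(\frac x2+\frac14,\frac y2+\frac{\sqrt3}{4})$. Put $s=\frac{\log 3}{\log 2}$. For $a\in\mathbb{R}$ let $L_{\theta,a}=\{(x,a+x\tan\theta):x\in\mathbb{R}\}$, $\mathrm{proj}_\theta(x,y)=y-x\tan\theta$, $\Delta_\theta=\mathrm{proj}_\theta(\Delta)\subset\mathbb{R}$, $E_{\theta,a}=L_{\theta,a}\cap\Delta$. $\nu$ is the unique Borel probability measure with $\nu=\sum_{i=0}^2\frac13\,\nu\circ S_i^{-1}$ and $\nu_\theta=\nu\circ\mathrm{proj}_\theta^{-1}$. For a Borel measure $\eta$ on $\mathbb{R}$, $\underline d_\eta(x)=\liminf_{r\to0}\frac{\log\eta(B_r(x))}{\log r}$ and $\overline d_\eta(x)=\limsup_{r\to0}\frac{\log\eta(B_r(x))}{\log r}$. $\underline{\dim}_B,\overline{\dim}_B$ are lower and upper box dimension. *)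

(* Defs.v *)
From HB Require Import structures.
From mathcomp Require Import all_boot all_order all_algebra.
From mathcomp Require Import all_classical all_reals all_analysis.

Set Implicit Arguments.
Unset Strict Implicit.
Unset Printing Implicit Defensive.

Import Order.TTheory GRing.Theory Num.Theory.
Import numFieldNormedType.Exports.

Local Open Scope classical_set_scope.
Local Open Scope ring_scope.

Section gasket.
Context {R : realType}.
Implicit Types (p q : R * R) (theta a : R).

Definition gasket_map (i : 'I_3) p : R * R :=
  match val i with
  | 0%N => (p.1 / 2, p.2 / 2)
  | 1%N => (p.1 / 2 + 1 / 2, p.2 / 2)
  | _ => (p.1 / 2 + 1 / 4, p.2 / 2 + Num.sqrt 3 / 4)
  end.

(** These conditions determine the set [D] uniquely (Hutchinson). *)
Definition is_gasket (D : set (R * R)) : Prop :=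
  [/\ D !=set0, compact D & D = \bigcup_i (gasket_map i @` D)].

(** These conditions determine the probability [nu] uniquely; the product
    sigma-algebra on [R * R] is the Borel sigma-algebra of the plane. *)
Definition is_gasket_measure
    (nu : probability (measurableTypeR R * measurableTypeR R)%type R) : Prop :=
  forall A, measurable A ->
    nu A = (\sum_(i < 3) (1 / 3)%:E * pushforward nu (gasket_map i) A)%E.

Definition slope_line theta a : set (R * R) := range (fun x => (x, a + x * tan theta)).

Definition slope_proj theta p : R := p.2 - p.1 * tan theta.

End gasket.

(** [lne] is the extended logarithm, so that a null ball contributes
    [log 0 / log r = +oo] for small [r]. *)
Section local_dimension.
Context {R : realType}.
Implicit Types (eta : set R -> \bar R) (x r : R).

Definition log_ratio_ball eta x r : \bar R :=
  (lne (eta (ball x r)) / (ln r)%:E)%E.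

Definition lower_local_dim eta x : \bar R := limf_einf (log_ratio_ball eta x) 0^'+.
Definition upper_local_dim eta x : \bar R := limf_esup (log_ratio_ball eta x) 0^'+.

End local_dimension.

Section box_dimension.
Context {R : realType}.
Implicit Types (p q : R * R) (U E : set (R * R)) (d : R).

(** The norm of [R * R] in the library is the sup norm. *)
Definition euclid_dist p q : R :=
  Num.sqrt ((p.1 - q.1) ^+ 2 + (p.2 - q.2) ^+ 2).

Definition diam_le U d : Prop :=
  forall p q, U p -> U q -> euclid_dist p q <= d.

Definition covered_by E d (n : nat) : Prop :=
  exists U : 'I_n -> set (R * R),
    (forall i, diam_le (U i) d) /\ E `<=` \bigcup_i U i.

(** Least number of sets of diameter at most [d] that cover [E]
    ([+oo] if no finite family does). *)
Definition cover_number E d : \bar R :=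
  ereal_inf [set (n%:R)%:E | n in covered_by E d].

Definition log_ratio_cover E d : \bar R :=
  (lne (cover_number E d) / (- ln d)%:E)%E.

Definition lower_box_dim E : \bar R := limf_einf (log_ratio_cover E) 0^'+.
Definition upper_box_dim E : \bar R := limf_esup (log_ratio_cover E) 0^'+.

End box_dimension.

(* Main.v *)
(** Projecting along the lines turns the gasket into the self-similar interval
    [I] of the maps [x => x / 2 + b_i], and [nu_theta] into the corresponding
    self-similar probability. Let [N n a] be the number of level-[n] triangles
    that meet the line. Each has measure [3 ^ -n] and lies in a strip of width
    comparable to [2 ^ -n], so [nu_theta] of a ball of radius about [2 ^ -n] is at
    least [3 ^ -n * N n a]. Conversely, a triangle that is close to the line but
    misses it is reached through an extreme vertex at every later level, so each
    level contributes boundedly many of them, and the ball has measure at most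
    [(3 * n + 1) * 3 ^ -n * N n a]. As the projection of the gasket is all of [I],
    each counted triangle contains a point of the slice; the triangles sit on a
    lattice of mesh [2 ^ -n], so [N n a] is comparable to the covering number of the
    slice at scale [2 ^ -n]. Taking logarithms, the linear factor disappears and the
    two logarithmic ratios add up to [s] in the limit. *)
Require Import Defs.
From HB Require Import structures.
From mathcomp Require Import all_boot all_order all_algebra.
From mathcomp Require Import all_classical all_reals all_analysis.
From mathcomp Require Import measurable_realfun ring lra zify.

Set Implicit Arguments.
Unset Strict Implicit.
Unset Printing Implicit Defensive.

Import Order.TTheory GRing.Theory Num.Theory.
Import numFieldNormedType.Exports.

Local Open Scope classical_set_scope.
Local Open Scope ring_scope.

(** * Lower and upper limits of two functions with convergent sum *)

Section limits_along_filter.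
Context {R : realType} {T : topologicalType}.
Variables (F : set_system T) (FF : ProperFilter F).
Implicit Types (phi psi : T -> \bar R) (f g : T -> R).

Lemma limf_esup_le phi (c : \bar R) :
  (\forall x \near F, (phi x <= c)%E) -> (limf_esup phi F <= c)%E.
Proof.
move=> Fc; rewrite limf_esupE.
apply: le_trans (ge_ereal_sup (S := [set phi x | x in [set x | (phi x <= c)%E]]) _).
  by apply: ereal_inf_lbound; exists [set x | (phi x <= c)%E].
by move=> _ [x /= xc <-].
Qed.

Lemma limf_esup_lt phi (c : \bar R) :
  (limf_esup phi F < c)%E -> \forall x \near F, (phi x < c)%E.
Proof.
rewrite limf_esupE => /ereal_inf_lt [_ [V FV <-] Vc].
apply: filterS FV => x Vx; apply: le_lt_trans Vc.
by apply: ereal_sup_ubound; exists x.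
Qed.

Lemma limf_einf_ge phi (c : \bar R) :
  (\forall x \near F, (c <= phi x)%E) -> (c <= limf_einf phi F)%E.
Proof.
move=> Fc; rewrite /limf_einf leeNr; apply: limf_esup_le.
by apply: filterS Fc => x; rewrite leeN2.
Qed.

Lemma limf_einf_gt phi (c : \bar R) :
  (c < limf_einf phi F)%E -> \forall x \near F, (c < phi x)%E.
Proof.
rewrite /limf_einf lteNr => /limf_esup_lt; apply: filterS => x.
by rewrite lteN2.
Qed.


(** Finiteness of the limits reduces sums of extended reals to real inequalities. *)
Lemma limf_einf_bounded phi f (M : R) :
  (\forall x \near F, phi x = (f x)%:E) ->
  (\forall x \near F, 0 <= f x) -> (\forall x \near F, f x <= M) ->
  exists l : R, limf_einf phi F = l%:E.
Proof.
move=> phif f0 fM.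
have : (0 <= limf_einf phi F)%E.
  by apply: limf_einf_ge; near=> x; rewrite (near phif x)// lee_fin; near: x.
have : (limf_einf phi F <= (M + 1)%:E)%E.
  rewrite leNgt; apply/negP => /limf_einf_gt Mphi.
  have [x] : exists x, [/\ (M + 1)%:E < phi x, phi x = (f x)%:E & (f x <= M)%R]%E.
    by apply: (@filter_ex _ F); near=> x; split; near: x.
  by case=> + E fxM; rewrite E lte_fin {E} => ?; lra.
by case: (limf_einf phi F) => // l _ _; exists l.
Unshelve. all: by end_near. Qed.

Lemma limf_esup_bounded phi f (M : R) :
  (\forall x \near F, phi x = (f x)%:E) ->
  (\forall x \near F, 0 <= f x) -> (\forall x \near F, f x <= M) ->
  exists l : R, limf_esup phi F = l%:E.
Proof.
move=> phif f0 fM.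
have : (limf_esup phi F <= M%:E)%E.
  by apply: limf_esup_le; near=> x; rewrite (near phif x)// lee_fin; near: x.
have : ((-1)%:E <= limf_esup phi F)%E.
  rewrite leNgt; apply/negP => /limf_esup_lt Mphi.
  have [x] : exists x, [/\ phi x < (-1)%:E, phi x = (f x)%:E & (0 <= f x)%R]%E.
    by apply: (@filter_ex _ F); near=> x; split; near: x.
  by case=> + E fxM; rewrite E lte_fin {E} => ?; lra.
by case: (limf_esup phi F) => // l _ _; exists l.
Unshelve. all: by end_near. Qed.

(** Up to a vanishing error [g] is [s - f], and the sign change turns a lower limit into an upper
    one. Non-negativity of both functions, with the bounded sum, bounds each of them. *)
Lemma limf_einf_add_esup phi psi f g (s : R) :
  (\forall x \near F, phi x = (f x)%:E) ->
  (\forall x \near F, psi x = (g x)%:E) ->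
  (\forall x \near F, 0 <= f x) -> (\forall x \near F, 0 <= g x) ->
  (forall e, 0 < e -> \forall x \near F, `|f x + g x - s| <= e) ->
  (limf_einf phi F + limf_esup psi F = s%:E)%E.
Proof.
move=> phif psig f0 g0 fgs.
have fM : \forall x \near F, f x <= s + 1.
  near=> x; have : `|f x + g x - s| <= 1 by near: x; exact: fgs.
  have : 0 <= g x by near: x.
  by rewrite ler_norml; lra.
have gM : \forall x \near F, g x <= s + 1.
  near=> x; have : `|f x + g x - s| <= 1 by near: x; exact: fgs.
  have : 0 <= f x by near: x.
  by rewrite ler_norml; lra.
have [l lE] := limf_einf_bounded phif f0 fM.
have [u uE] := limf_esup_bounded psig g0 gM.
rewrite lE uE -EFinD; congr (_%:E); apply/eqP; rewrite eq_le; apply/andP; split.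
  (* A quarter of the excess: one [e] is lost to the lower limit and one to the error of the sum,
     and [2 * e] is still below the excess. *)
  rewrite leNgt; apply/negP => slu; pose e := (l + u - s) / 4.
  have e0 : 0 < e by rewrite /e; lra.
  have : (limf_esup psi F <= (s - l + 2 * e)%:E)%E.
    apply: limf_esup_le; near=> x.
    rewrite (near psig x)// lee_fin.
    have : `|f x + g x - s| <= e by near: x; exact: fgs.
    have : ((l - e)%:E < phi x)%E.
      by near: x; apply: limf_einf_gt; rewrite lE lte_fin; lra.
    by rewrite (near phif x)// lte_fin ler_norml; lra.
  by rewrite uE lee_fin /e; lra.
rewrite leNgt; apply/negP => slu; pose e := (s - l - u) / 4.
have e0 : 0 < e by rewrite /e; lra.
have : ((s - u - 2 * e)%:E <= limf_einf phi F)%E.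
  apply: limf_einf_ge; near=> x.
  rewrite (near phif x)// lee_fin.
  have : `|f x + g x - s| <= e by near: x; exact: fgs.
  have : (psi x < (u + e)%:E)%E.
    by near: x; apply: limf_esup_lt; rewrite uE lte_fin; lra.
  by rewrite (near psig x)// lte_fin ler_norml; lra.
by rewrite lE lee_fin /e; lra.
Unshelve. all: by end_near. Qed.

End limits_along_filter.

(** * Logarithmic ratios at dyadic scales *)

Section logarithms.
Context {R : realType}.

Lemma dyadic_scale (r : R) : 0 < r <= 1 ->
  exists n : nat, (1 / 2) ^+ n.+1 < r <= (1 / 2) ^+ n.
Proof.
move=> /andP[r0 r1].
have [m rm] : exists m : nat, (1 / 2) ^+ m < r.
  have [|m _ /(_ m (leqnn m))] := cvgr_lt (0 : R) (@cvg_expr R (1 / 2) _) _ r0.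
    by rewrite ger0_norm; lra.
  by exists m.
have exm : exists m, (1 / 2) ^+ m < r by exists m.
case: (ex_minnP exm) => -[|n] rn min; first by move: rn; rewrite expr0; lra.
exists n; rewrite rn leNgt; apply/negP => /min.
by rewrite ltnn.
Qed.

(** The slope [d] is free, so that the logarithm of the factor linear in [n] can be made small
    against [n]. *)
Lemma ln_le_linear (x d : R) : 0 < x -> 0 < d -> ln x <= d * x - ln d.
Proof.
move=> x0 d0; have : ln (d * x) < d * x by apply: ln_sublinear; rewrite mulr_gt0.
rewrite lnM ?posrE//; lra.
Qed.

(* [r ^ s = 3 ^ - log2 (1 / r)], so up to a factor linear in [n] the hypotheses say
   that [v] is [r ^ s * c]. *)
Lemma log_ratio_sum (v c : R -> R) (C1 C2 : R) :
  0 < C1 -> 0 < C2 ->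
  (\forall r \near 0^'+, 1 <= c r) ->
  (\forall r \near 0^'+, forall n, (1 / 2) ^+ n.+1 < r <= (1 / 2) ^+ n ->
     C1 * (1 / 3) ^+ n * c r <= v r <= C2 * (3 * n + 1)%:R * (1 / 3) ^+ n * c r) ->
  forall e, 0 < e ->
  \forall r \near 0^'+, `|ln (v r) / ln r + ln (c r) / - ln r - ln 3 / ln 2| <= e.
Proof.
move=> C10 C20 c1 vc e e0.
have ln2 : 0 < ln 2 :> R by rewrite ln_gt0// ltr1n.
have ln3 : 0 < ln 3 :> R by rewrite ln_gt0// ltr1n.
(* The budget is [e * - ln r]. Since [- ln r >= n * ln 2], half of it pays [3 * d * n], the growing
   part of the bound for [ln (3 * n + 1)]; as [- ln r >= X], the other half pays the constants
   collected in [K]. *)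
pose d := e * ln 2 / 6.
have d0 : 0 < d by rewrite /d !mulr_gt0// invr_gt0.
pose K := `|ln C1| + `|ln C2| + d + `|ln d| + ln 3.
have K0 : 0 <= K by rewrite /K !addr_ge0 // ltW.
pose X := 1 + 2 * K / e.
have X0 : 0 < X by rewrite /X ltr_wpDr // ?divr_ge0 ?mulr_ge0 // ltW.
near=> r.
have r0 : 0 < r by near: r; exact: nbhs_right_gt.
have rX : r < expR (- X) by near: r; apply: nbhs_right_lt; exact: expR_gt0.
have Xr : X <= - ln r.
  by rewrite lerNr -[leRHS]expRK ler_ln ?posrE ?expR_gt0// ltW.
have r1 : r <= 1.
  by apply: le_trans (ltW rX) _; rewrite -expR0 ler_expR oppr_le0 ltW.
have [n nr] := @dyadic_scale r (introT andP (conj r0 r1)).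
have cr : 1 <= c r by near: r.
have /(_ n nr)/andP[v1 v2] : forall n, (1 / 2) ^+ n.+1 < r <= (1 / 2) ^+ n ->
    C1 * (1 / 3) ^+ n * c r <= v r <= C2 * (3 * n + 1)%:R * (1 / 3) ^+ n * c r.
  by near: r.
have cr0 : 0 < c r by lra.
have n0 : 0 < (3 * n + 1)%:R :> R by rewrite ltr0n addn1.
have p0 : 0 < (1 / 3) ^+ n :> R by rewrite exprn_gt0.
have vr0 : 0 < v r by apply: lt_le_trans v1; rewrite !mulr_gt0.
have lnX (x : R) k : 0 < x -> ln ((1 / x) ^+ k) = - k%:R * ln x.
  by move=> x0; rewrite lnXn ?divr_gt0// div1r lnV ?posrE// -[LHS]mulr_natl mulrN mulNr.
have lv1 : ln C1 - n%:R * ln 3 + ln (c r) <= ln (v r).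
  rewrite -[X in _ + X + _]mulNr -(lnX 3)// -!lnM ?posrE ?mulr_gt0//.
  by rewrite ler_ln ?posrE// !mulr_gt0.
have lv2 : ln (v r) <= ln C2 + ln (3 * n + 1)%:R - n%:R * ln 3 + ln (c r).
  rewrite -[X in _ + X + _]mulNr -(lnX 3)// -!lnM ?posrE ?mulr_gt0//.
  by rewrite ler_ln ?posrE// !mulr_gt0.
have [r1' r2'] : - n.+1%:R * ln 2 <= ln r /\ ln r <= - n%:R * ln 2.
  by move/andP: nr => [/ltW ? ?]; rewrite -!lnX// !ler_ln ?posrE ?exprn_gt0.
have ln_n : ln (3 * n + 1)%:R <= d * (3 * n%:R + 1) - ln d :> R.
  by apply: le_trans (ln_le_linear n0 d0) _; rewrite natrD natrM.
have lr : ln r < 0 by lra.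
set s := ln 3 / ln 2.
have s0 : 0 < s by rewrite divr_gt0.
have sE : s * ln 2 = ln 3 by rewrite /s mulfVK ?gt_eqF.
(* It remains to compare [v r / c r] with [r ^ s], which lies between [3 ^ -(n + 1)] and [3 ^ -n];
   this gap is the term [ln 3] of [K]. *)
have -> : ln (v r) / ln r + ln (c r) / - ln r - s =
    (ln (v r) - ln (c r) - s * ln r) / ln r by field; rewrite ?lt_eqF.
rewrite normrM normfV (ltr0_norm lr) ler_pdivrMr ?oppr_gt0//.
have s1 : - (n.+1%:R * ln 3) <= s * ln r.
  by rewrite -sE mulrCA -mulrN ler_pM2l// -mulNr.
have s2 : s * ln r <= - (n%:R * ln 3).
  by rewrite -sE mulrCA -mulrN ler_pM2l// -mulNr.
have eX : K + 3 * d * n%:R <= e * - ln r.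
  have : e * X <= e * - ln r by rewrite ler_pM2l.
  have -> : e * X = e + 2 * K by rewrite /X; field; rewrite gt_eqF.
  have : e * (n%:R * ln 2) <= e * - ln r by rewrite ler_pM2l// lerNr -mulNr.
  have -> : e * (n%:R * ln 2) = 6 * d * n%:R by rewrite /d; field.
  lra.
apply: le_trans eX.
have h1 := ler_norm (ln C1); have h1' := ler_norm (- ln C1); rewrite normrN in h1'.
have h2 := ler_norm (ln C2); have h2' := ler_norm (- ln C2); rewrite normrN in h2'.
have h3 := ler_norm (ln d); have h3' := ler_norm (- ln d); rewrite normrN in h3'.
have dn : 0 <= 3 * d * n%:R by rewrite mulr_ge0 ?ler0n// mulr_ge0// ltW.
have : n.+1%:R = n%:R + 1 :> R by rewrite -natr1.
move=> nS; rewrite nS mulrDl mul1r in s1.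
rewrite mulrDr mulr1 mulrA [d * 3]mulrC in ln_n.
rewrite /K ler_norml; apply/andP; split; lra.
Unshelve. all: by end_near. Qed.

End logarithms.

(** * Self-similar probabilities on the line *)

Section self_similar_measure.
Context {R : realType}.
Variables (mu : probability (measurableTypeR R) R) (b0 b1 b2 : R).
Hypotheses (b10 : b1 < b0) (b02 : b0 < b2).

Let P (A : set R) : R := fine (mu A).

Hypothesis mu_self_similar : forall A : set R, measurable A ->
  P A = (P ((fun x => x / 2 + b0) @^-1` A) + P ((fun x => x / 2 + b1) @^-1` A) +
         P ((fun x => x / 2 + b2) @^-1` A)) / 3.

Let muE (A : set R) : measurable A -> mu A = (P A)%:E.
Proof. by move=> mA; rewrite fineK// fin_num_measure. Qed.

Let P_le (A B : set R) : measurable A -> measurable B -> A `<=` B -> P A <= P B.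
Proof.
by move=> mA mB AB; rewrite -lee_fin -!muE// le_measure ?inE.
Qed.

Let P_ge0 (A : set R) : 0 <= P A.
Proof. by rewrite fine_ge0. Qed.

Let P_le1 (A : set R) : measurable A -> P A <= 1.
Proof. by move=> mA; rewrite -lee_fin -muE// probability_le1. Qed.

Let PC (A : set R) : measurable A -> P (~` A) = 1 - P A.
Proof.
move=> mA; apply: EFin_inj; rewrite -muE; last exact: measurableC.
by rewrite probability_setC// muE.
Qed.

(** * Support of a self-similar probability *)

(** Continuity from above: the complements of the balls decrease to the empty set. *)
Lemma null_of_escaping (A : set R) : measurable A ->
  (forall k : nat, P A <= P (~` ball (0 : R) k%:R)) -> P A = 0.
Proof.
move=> mA Ak; apply/eqP; rewrite eq_le P_ge0 andbT.
have mB k : measurable (~` ball (0 : R) k%:R : set (measurableTypeR R)).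
  by apply: measurableC; exact: measurable_ball.
have B0 : \bigcap_k (~` ball (0 : R) k%:R) = set0.
  rewrite -setC_bigcup -[RHS]setCT; congr (~` _).
  apply/seteqP; split=> // x _; exists (Num.truncn `|x|).+1 => //=.
  by rewrite /ball/= sub0r normrN truncnS_gt.
pose B k : set (measurableTypeR R) := ~` ball (0 : R) k%:R.
have B_fin : (mu (B 0%N) < +oo)%E.
  exact: le_lt_trans (probability_le1 _ (mB _)) (ltry _).
have B_decr : {homo B : m n / (m <= n)%N >-> (n <= m)%O}.
  move=> m n mn; apply/subsetPset; apply: subsetC => x.
  by rewrite /ball/= => /lt_le_trans; apply; rewrite ler_nat.
have mB' : measurable (\bigcap_k B k) by rewrite B0; exact: measurable0.
have cvg := nonincreasing_cvg_mu B_fin mB mB' B_decr.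
rewrite -lee_fin -(muE mA) (_ : 0%:E = mu (\bigcap_k B k)); last by rewrite B0 measure0.
rewrite -(cvg_lim _ cvg)//.
apply: lime_ge; first by apply/cvg_ex; eexists; exact: cvg.
by apply: nearW => k /=; rewrite (muE mA) (muE (mB k)) lee_fin.
Qed.

Lemma exists_pow2_gt (x e : R) : 0 < e -> exists n : nat, x < 2 ^+ n * e.
Proof.
move=> e0; exists (Num.truncn (`|x| / e)).+1.
rewrite -ltr_pdivrMr//; apply: (@le_lt_trans _ _ (`|x| / e)).
  by rewrite ler_pM2r ?invr_gt0// ler_norm.
apply: lt_le_trans (truncnS_gt _) _.
by rewrite -natrX ler_nat ltnW// ltn_expl.
Qed.

(** The point [2 * b2] is fixed by the map with the largest translation. Pulling the half-line back
    by any of the maps at least doubles its distance to this point, so its mass is at most that of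
    half-lines arbitrarily far away. *)
Lemma right_tail_null (e : R) : 0 < e -> P `]2 * b2 + e, +oo[%classic = 0.
Proof.
move=> e0; have step d : 0 < d ->
    P `]2 * b2 + d, +oo[%classic <= P `]2 * b2 + 2 * d, +oo[%classic.
  move=> d0; rewrite mu_self_similar//.
  have pre b : b <= b2 -> P ((fun x => x / 2 + b) @^-1` `]2 * b2 + d, +oo[) <=
      P `]2 * b2 + 2 * d, +oo[%classic.
    move=> bb2.
    have -> : (fun x => x / 2 + b) @^-1` `]2 * b2 + d, +oo[ =
        `]2 * (2 * b2 + d - b), +oo[%classic.
      by apply/seteqP; split=> x /=; rewrite !in_itv/= !andbT; lra.
    apply: P_le => // x /=; rewrite !in_itv/= !andbT; lra.
  have := pre b0 (ltW b02); have := pre b2 (lexx _).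
  have := pre b1 (ltW (lt_trans b10 b02)); lra.
have iter n : P `]2 * b2 + e, +oo[%classic <= P `]2 * b2 + 2 ^+ n * e, +oo[%classic.
  elim: n => [|n IH]; first by rewrite expr0 mul1r.
  by apply: le_trans IH _; rewrite exprS -mulrA; apply: step; rewrite mulr_gt0.
apply: null_of_escaping => // k.
have [n kn] := exists_pow2_gt (k%:R - 2 * b2) e0.
apply: le_trans (iter n) _; apply: P_le => //.
  by apply: measurableC; exact: measurable_ball.
by move=> x /=; rewrite in_itv/= andbT /ball/= sub0r normrN ltr_norml => ?; lra.
Qed.

Lemma left_tail_null (e : R) : 0 < e -> P `]-oo, 2 * b1 - e[%classic = 0.
Proof.
move=> e0; have step d : 0 < d ->
    P `]-oo, 2 * b1 - d[%classic <= P `]-oo, 2 * b1 - 2 * d[%classic.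
  move=> d0; rewrite mu_self_similar//.
  have pre b : b1 <= b -> P ((fun x => x / 2 + b) @^-1` `]-oo, 2 * b1 - d[) <=
      P `]-oo, 2 * b1 - 2 * d[%classic.
    move=> bb2.
    have -> : (fun x => x / 2 + b) @^-1` `]-oo, 2 * b1 - d[ =
        `]-oo, 2 * (2 * b1 - d - b)[%classic.
      by apply/seteqP; split=> x /=; rewrite !in_itv/=; lra.
    apply: P_le => // x /=; rewrite !in_itv/=; lra.
  have := pre b0 (ltW b10); have := pre b1 (lexx _).
  have := pre b2 (ltW (lt_trans b10 b02)); lra.
have iter n : P `]-oo, 2 * b1 - e[%classic <= P `]-oo, 2 * b1 - 2 ^+ n * e[%classic.
  elim: n => [|n IH]; first by rewrite expr0 mul1r.
  by apply: le_trans IH _; rewrite exprS -mulrA; apply: step; rewrite mulr_gt0.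
apply: null_of_escaping => // k.
have [n kn] := exists_pow2_gt (k%:R + 2 * b1) e0.
apply: le_trans (iter n) _; apply: P_le => //.
  by apply: measurableC; exact: measurable_ball.
by move=> x /=; rewrite in_itv/= /ball/= sub0r normrN ltr_norml => ?; lra.
Qed.

Lemma ball_full (x r : R) :
  x - r < 2 * b1 -> 2 * b2 < x + r -> P (ball x r) = 1.
Proof.
move=> xr1 xr2.
(* Half of the smaller margin, so that the two null tails cover the complement of the ball. *)
pose e := Num.min (2 * b1 - (x - r)) (x + r - 2 * b2) / 2.
have e0 : 0 < e by rewrite divr_gt0// lt_min; apply/andP; split; lra.
have e1 : 2 * e <= 2 * b1 - (x - r) by rewrite /e mulrC divfK// ge_min lexx.
have e2 : 2 * e <= x + r - 2 * b2 by rewrite /e mulrC divfK// ge_min lexx orbT.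
have mB : measurable (ball x r : set (measurableTypeR R)) by exact: measurable_ball.
pose T1 : set (measurableTypeR R) := `]2 * b2 + e, +oo[%classic.
pose T2 : set (measurableTypeR R) := `]-oo, 2 * b1 - e[%classic.
have mT1 : measurable T1 by exact: measurable_itv.
have mT2 : measurable T2 by exact: measurable_itv.
have mBC : measurable (~` ball x r : set (measurableTypeR R)) by exact: measurableC.
have sub : ~` ball x r `<=` T1 `|` T2.
  move=> y /= yB; rewrite /T1 /T2 /setU/= !in_itv/= andbT.
  have [|yr] := ltP (2 * b2 + e) y; [by left|right].
  rewrite ltNge; apply/negP => yl; apply: yB.
  by rewrite /ball/= ltr_norml; lra.
have : (mu (~` ball x r) <= mu T1 + mu T2)%E.
  apply: (@le_trans _ _ (mu (T1 `|` T2))); last exact: measureU2.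
  by apply: le_measure; rewrite ?inE//; exact: measurableU.
rewrite (muE mBC) (muE mT1) (muE mT2) -EFinD lee_fin.
rewrite (right_tail_null e0) (left_tail_null e0) PC//.
by have := P_le1 mB; lra.
Qed.

Lemma ball_null (x r e : R) : 0 < e ->
  (x + r <= 2 * b1 - e) || (2 * b2 + e <= x - r) -> P (ball x r) = 0.
Proof.
move=> e0 xr; apply/eqP; rewrite eq_le P_ge0 andbT.
have mB : measurable (ball x r : set (measurableTypeR R)) by exact: measurable_ball.
case/orP: xr => xr.
  rewrite -(left_tail_null e0); apply: P_le => // y /=.
  by rewrite /ball/= in_itv/= ltr_norml; lra.
rewrite -(right_tail_null e0); apply: P_le => // y /=.
by rewrite /ball/= in_itv/= andbT ltr_norml; lra.
Qed.

(** * Measures of balls and numbers of words *)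

Lemma ball_self_similar (x r : R) :
  P (ball x r) = (P (ball (2 * (x - b0)) (2 * r)) + P (ball (2 * (x - b1)) (2 * r)) +
                  P (ball (2 * (x - b2)) (2 * r))) / 3.
Proof.
have mB : measurable (ball x r : set (measurableTypeR R)) by exact: measurable_ball.
rewrite mu_self_similar//.
have pre b : (fun y => y / 2 + b) @^-1` ball x r = ball (2 * (x - b)) (2 * r).
  by apply/seteqP; split=> y; rewrite /ball/= !ltr_norml; lra.
by rewrite !pre.
Qed.

(* The number of words [w] of length [n] such that [x] lies in the image of
   the interval from [2 * b1] to [2 * b2] under the composition of the maps
   [y => y / 2 + b_i], [i] in [w]. *)
Fixpoint hits (n : nat) (x : R) : nat :=
  if n is k.+1 then
    (hits k (2 * (x - b0))%R + hits k (2 * (x - b1))%R + hits k (2 * (x - b2))%R)%N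
  else nat_of_bool (2 * b1 <= x <= 2 * b2)%R.

Lemma hits_out n x : ~~ (2 * b1 <= x <= 2 * b2) -> hits n x = 0%N.
Proof.
elim: n x => [|n IH] x /=; first by move/negbTE ->.
have I_sub b : b1 <= b <= b2 -> 2 * b1 <= 2 * (x - b) <= 2 * b2 -> 2 * b1 <= x <= 2 * b2.
  by move=> /andP[? ?] /andP[? ?]; apply/andP; split; lra.
by move=> xI; rewrite !IH//; apply: contra (I_sub _ _) xI; move: b10 b02 => ? ?; apply/andP; split; lra.
Qed.

Lemma hits_gt0 n x : 2 * b1 <= x <= 2 * b2 -> (0 < hits n x)%N.
Proof.
move: b10 b02 => ? ?; elim: n x => [|n IH] x xI /=; first by rewrite xI.
rewrite !addn_gt0.
(* The images of the interval under the maps with translations [b1] and [b2] meet at [b1 + b2] and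
   together cover it. *)
have [x1|x1] := leP x (b1 + b2).
  by rewrite (IH (2 * (x - b1))) ?orbT//; lra.
by rewrite (IH (2 * (x - b2))) ?orbT//; lra.
Qed.

(** A radius above the length of the interval gives full measure to balls centred in it. Balls and
    [hits] obey the same recursion, which carries this to every level. *)
Lemma ball_ge_hits (l : R) : 2 * (b2 - b1) < l ->
  forall n x, (1 / 3) ^+ n * (hits n x)%:R <= P (ball x (l * (1 / 2) ^+ n)).
Proof.
move=> bl; elim=> [|n IH] x /=.
  rewrite !expr0 mul1r mulr1; have [xI|_] := boolP (2 * b1 <= x <= 2 * b2); last by rewrite P_ge0.
  by rewrite ball_full//; lra.
have half : 2 * (l * (1 / 2) ^+ n.+1) = l * (1 / 2) ^+ n by rewrite exprS; field.
rewrite ball_self_similar half.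
have := IH (2 * (x - b0)); have := IH (2 * (x - b1)); have := IH (2 * (x - b2)).
rewrite !natrD exprS -!mulrA !mulrDr; lra.
Qed.

(* Outside the interval only the map fixing the nearer endpoint contributes at each
   step. *)
Lemma ball_le_out (c : R) : 0 < c -> 2 * c <= b0 - b1 -> 2 * c <= b2 - b0 ->
  forall n x, ~~ (2 * b1 <= x <= 2 * b2) ->
  P (ball x (c * (1 / 2) ^+ n)) <= (1 / 3) ^+ n.
Proof.
move=> c0 c1 c2; move: b10 b02 => ? ?; elim=> [|n IH] x xI.
  by rewrite expr0 P_le1//; exact: measurable_ball.
have cn : c * (1 / 2) ^+ n <= c.
  by rewrite ger_pMr// exprn_ile1//; lra.
have half : 2 * (c * (1 / 2) ^+ n.+1) = c * (1 / 2) ^+ n by rewrite exprS; field.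
rewrite ball_self_similar half.
have [x1|x1] := ltP x (2 * b1).
  (* The gap [b0 - b1 >= 2 * c] puts these two centres at least [4 * c] to the left of the interval,
     while the radius is at most [c]. *)
  rewrite (@ball_null (2 * (x - b0)) _ c)//; last by apply/orP; left; lra.
  rewrite (@ball_null (2 * (x - b2)) _ c)//; last by apply/orP; left; lra.
  have := IH (2 * (x - b1)); rewrite exprS => /(_ _); lra.
have x2 : 2 * b2 < x by move: xI; rewrite x1/= -ltNge.
rewrite (@ball_null (2 * (x - b0)) _ c)//; last by apply/orP; right; lra.
rewrite (@ball_null (2 * (x - b1)) _ c)//; last by apply/orP; right; lra.
have := IH (2 * (x - b2)); rewrite exprS => /(_ _); lra.
Qed.

(* Each step of the recursion loses at most [3 * (1 / 3) ^+ n], for the children of [x]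
   that leave the interval, and [hits] is positive inside it: hence the factor linear
   in [n]. *)
Lemma ball_le_hits (c : R) : 0 < c -> 2 * c <= b0 - b1 -> 2 * c <= b2 - b0 ->
  forall n x, 2 * b1 <= x <= 2 * b2 ->
  P (ball x (c * (1 / 2) ^+ n)) <= (3 * n + 1)%:R * (1 / 3) ^+ n * (hits n x)%:R.
Proof.
move=> c0 c1 c2; move: b10 b02 => ? ?; elim=> [|n IH] x xI.
  by rewrite /= xI expr0 !mulr1 P_le1//; exact: measurable_ball.
have any y : P (ball y (c * (1 / 2) ^+ n)) <=
    (3 * n + 1)%:R * (1 / 3) ^+ n * (hits n y)%:R + (1 / 3) ^+ n.
  have p0 : 0 <= (1 / 3) ^+ n :> R by rewrite exprn_ge0.
  have [yI|yI] := boolP (2 * b1 <= y <= 2 * b2).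
    by apply: le_trans (IH y yI) _; rewrite lerDl.
  by rewrite (hits_out _ yI) mulr0 add0r ball_le_out.
have half : 2 * (c * (1 / 2) ^+ n.+1) = c * (1 / 2) ^+ n by rewrite exprS; field.
rewrite ball_self_similar half.
have := any (2 * (x - b0)); have := any (2 * (x - b1)); have := any (2 * (x - b2)).
have h1 : 1 <= (hits n.+1 x)%:R :> R by rewrite ler1n hits_gt0.
have p0 : 0 <= (1 / 3) ^+ n :> R by rewrite exprn_ge0.
(* Raising the factor from [3 * n + 1] to [3 * n.+1 + 1] adds exactly the right-hand side, and the
   three losses, averaged with weight [1 / 3], make up the left-hand side. *)
have : (1 / 3) ^+ n <= (1 / 3) ^+ n * (hits n.+1 x)%:R :> R by rewrite ler_peMr.
have -> : (3 * n.+1 + 1)%:R = (3 * n + 1)%:R + 3 :> R by rewrite mulnS -addnA addnC natrD.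
have -> : hits n.+1 x = (hits n (2 * (x - b0))%R + hits n (2 * (x - b1))%R +
  hits n (2 * (x - b2))%R)%N by [].
move: ((3 * n + 1)%:R : R) => k; rewrite exprS !natrD; move: ((1 / 3) ^+ n) p0 => p p0.
move: ((hits _ _)%:R) => u; move: ((hits _ _)%:R) => v; move: ((hits _ _)%:R) => w.
have -> : (k + 3) * (1 / 3 * p) * (u + v + w) =
  (k * p * u + k * p * v + k * p * w) / 3 + p * (u + v + w) by field.
lra.
Qed.

End self_similar_measure.

(** * Slices of the gasket *)

Section plane_covers.
Context {R : realType}.
Implicit Types (p q v : R * R) (E F : set (R * R)).

Lemma euclid_dist_ge1 p q : `|p.1 - q.1| <= euclid_dist p q.
Proof.
rewrite /euclid_dist -sqrtr_sqr ler_wsqrtr// lerDl sqr_ge0//.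
Qed.

Lemma euclid_dist_ge2 p q : `|p.2 - q.2| <= euclid_dist p q.
Proof.
by rewrite /euclid_dist -sqrtr_sqr ler_wsqrtr// lerDr sqr_ge0.
Qed.

Lemma euclid_dist_le p q : euclid_dist p q <= `|p.1 - q.1| + `|p.2 - q.2|.
Proof.
rewrite /euclid_dist; move: (p.1 - q.1) (p.2 - q.2) => x y.
have -> : `|x| + `|y| = Num.sqrt ((`|x| + `|y|) ^+ 2) by rewrite sqrtr_sqr [RHS]ger0_norm ?addr_ge0.
by apply: ler_wsqrtr; rewrite sqrrD !real_normK ?num_real// lerD2r lerDl mulrn_wge0// mulr_ge0.
Qed.

(** A common form of the three gasket maps, parametrized by the translation. *)
Definition half_map v p : R * R := (p.1 / 2 + v.1, p.2 / 2 + v.2).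

Lemma euclid_dist_half v p q :
  euclid_dist (half_map v p) (half_map v q) = euclid_dist p q / 2.
Proof.
rewrite /euclid_dist /=.
have -> : (p.1 / 2 + v.1 - (q.1 / 2 + v.1)) ^+ 2 + (p.2 / 2 + v.2 - (q.2 / 2 + v.2)) ^+ 2 =
    (1 / 2) ^+ 2 * ((p.1 - q.1) ^+ 2 + (p.2 - q.2) ^+ 2) by field.
by rewrite sqrtrM ?sqr_ge0// sqrtr_sqr ger0_norm// mulrC mul1r.
Qed.

Lemma covered_by_half E d n v :
  Defs.covered_by E d n -> Defs.covered_by (half_map v @` E) (d / 2) n.
Proof.
move=> [U [Ud EU]]; exists (fun i => half_map v @` U i); split.
  move=> i _ _ [p Up <-] [q Uq <-].
  by rewrite euclid_dist_half ler_pM2r ?invr_gt0//; exact: Ud Up Uq.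
by move=> _ [p /EU[i _ Uip] <-]; exists i => //; exists p.
Qed.

Lemma covered_byU E F d m n :
  Defs.covered_by E d m -> Defs.covered_by F d n -> Defs.covered_by (E `|` F) d (m + n).
Proof.
move=> [U [Ud EU]] [V [Vd FV]].
exists (fun i => match fintype.split i with inl j => U j | inr k => V k end); split.
  by move=> i; case: (fintype.split i).
move=> p [/EU[i _ Uip]|/FV[i _ Vip]].
- by exists (unsplit (inl i)) => //; rewrite unsplitK.
- by exists (unsplit (inr i)) => //; rewrite unsplitK.
Qed.

Lemma covered_by_le E F d e n :
  E `<=` F -> d <= e -> Defs.covered_by F d n -> Defs.covered_by E e n.
Proof.
move=> EF de [U [Ud FU]]; exists U; split; last exact: subset_trans FU.
by move=> i p q Up Uq; apply: le_trans de; exact: Ud Up Uq.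
Qed.

(** The infimum of a non-empty set of naturals is attained, which makes the covering number a
    natural number comparable with [hits]. *)
Lemma cover_number_min E d n : Defs.covered_by E d n ->
  exists k, [/\ Defs.covered_by E d k, forall m, Defs.covered_by E d m -> (k <= m)%N &
                cover_number E d = k%:R%:E].
Proof.
move=> En; have exn : exists m, `[< Defs.covered_by E d m >] by exists n; exact/asboolP.
case: (ex_minnP exn) => k /asboolP Ek k_min.
have {}k_min m : Defs.covered_by E d m -> (k <= m)%N by move=> /asboolP/k_min.
exists k; split=> //; apply/eqP; rewrite eq_le; apply/andP; split.
  by apply: ereal_inf_lbound; exists k.
by apply: le_ereal_inf_tmp => _ [m /k_min km <-]; rewrite lee_fin ler_nat.
Qed.

End plane_covers.

(** * The projection of the gasket and its fibres *)

Section gasket_slices.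
Context {R : realType}.
Variables (theta : R) (D : set (R * R)).
Hypothesis hD : is_gasket D.
Implicit Types (p q : R * R) (a x : R).

Local Notation t := (tan theta).
Let v0 : R * R := (0, 0).
Let v1 : R * R := (1 / 2, 0).
Let v2 : R * R := (1 / 4, Num.sqrt 3 / 4).
(** The projections of the translations [v0], [v1], [v2]. The order [b1 < b0 < b2] amounts to
    [0 < t < Num.sqrt 3]. *)
Local Notation b0 := (0 : R).
Local Notation b1 := (- (t / 2)).
Local Notation b2 := ((Num.sqrt 3 - t) / 4).

Local Notation proj := (slope_proj theta).
Local Notation slice a := (slope_line theta a `&` D).

Lemma slope_lineP a p : slope_line theta a p <-> proj p = a.
Proof.
rewrite /slope_proj; split; first by move=> [x _ <-] /=; rewrite addrK.
by move=> <-; exists p.1 => //; case: p => p1 p2 /=; rewrite subrK.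
Qed.

Lemma gasket_half_mapP p : D p <->
  exists2 q, D q & p = half_map v0 q \/ p = half_map v1 q \/ p = half_map v2 q.
Proof.
have [_ _ DE] := hD; rewrite {1}DE; split.
  move=> [[[|[|[|//]]] lti3] _ [q Dq <-]]; exists q => //; rewrite /gasket_map /half_map /=.
  - by left; rewrite !addr0.
  - by right; left; rewrite !addr0.
  - by right; right.
move=> [q Dq [->|[->|->]]].
- by exists (Ordinal (isT : (0 < 3)%N)) => //; exists q; rewrite // /gasket_map /half_map /= !addr0.
- by exists (Ordinal (isT : (1 < 3)%N)) => //; exists q; rewrite // /gasket_map /half_map /= addr0.
- by exists (Ordinal (isT : (2 < 3)%N)) => //; exists q.
Qed.

Lemma proj_half_map v q : proj (half_map v q) = proj q / 2 + proj v.
Proof. by rewrite /slope_proj /half_map /=; field. Qed.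

Let proj_v0 : proj v0 = b0. Proof. by rewrite /slope_proj /=; ring. Qed.
Let proj_v1 : proj v1 = b1. Proof. by rewrite /slope_proj /=; field. Qed.
Let proj_v2 : proj v2 = b2. Proof. by rewrite /slope_proj /=; field. Qed.

Lemma gasket_bounded : exists2 M : R, 0 < M & forall p, D p -> `|p.1| <= M /\ `|p.2| <= M.
Proof.
have [_ cD _] := hD; have [M [_ MD]] := compact_bounded cD.
exists (`|M| + 1); first by rewrite ltr_wpDl.
move=> p Dp; have := MD (`|M| + 1) _ p Dp.
by rewrite ltr_pwDr ?ler_norm// => /(_ isT) /=; rewrite prod_normE/= ge_max => /andP.
Qed.

Lemma le0_of_geometric (x K : R) : (forall n, x <= K * (1 / 2) ^+ n) -> x <= 0.
Proof.
move=> xK; have cvg : K * (1 / 2) ^+ n @[n --> \oo] --> (0 : R).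
  by rewrite -[0](mulr0 K); apply: cvgM; [exact: cvg_cst|apply: cvg_expr; rewrite ger0_norm; lra].
by rewrite -(cvg_lim _ cvg)//; apply: limr_ge; [apply/cvg_ex; eexists; exact: cvg|exact: nearW].
Qed.

Hypothesis t_gt0 : 0 < t.
Hypothesis t_lt : t < Num.sqrt 3.

Let b10 : b1 < b0. Proof. by move: t_gt0 => ?; lra. Qed.
Let b02 : b0 < b2. Proof. by move: t_lt => ?; lra. Qed.

Lemma proj_bounded : exists2 K : R, 0 < K & forall p, D p -> `|proj p| <= K.
Proof.
have [M M0 DM] := gasket_bounded.
exists (M + M * t); first by rewrite addr_gt0// mulr_gt0.
move=> p /DM[p1 p2]; rewrite /slope_proj.
apply: le_trans (ler_normB _ _) _; rewrite lerD// normrM ler_pM//.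
by rewrite ger0_norm// ltW.
Qed.

Lemma proj_gasket_sub p : D p -> 2 * b1 <= proj p <= 2 * b2.
Proof.
have [K K0 DK] := proj_bounded.
move: b10 b02 => b10' b02'.
(* At [n = 0] the bounds are [- K] and [K]; writing [q] as the image of a gasket point halves the
   excess over the interval. *)
have bound n : forall q, D q -> 2 * b1 - (K + 2 * b1) * (1 / 2) ^+ n <= proj q <=
    2 * b2 + (K - 2 * b2) * (1 / 2) ^+ n.
  elim: n => [|n IH] q Dq.
    by have := DK _ Dq; rewrite expr0 !mulr1 ler_norml => /andP[? ?]; apply/andP; split; lra.
  have /gasket_half_mapP[q' Dq' qE] := Dq.
  have /andP[l u] := IH _ Dq'; rewrite exprS.
  by case: qE => [->|[->|->]]; rewrite proj_half_map ?proj_v0 ?proj_v1 ?proj_v2;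
    apply/andP; split; lra.
move=> Dp; apply/andP; split; rewrite -subr_le0.
  by apply: (@le0_of_geometric _ (K + 2 * b1)) => n; have /andP[? ?] := bound n _ Dp; lra.
by apply: (@le0_of_geometric _ (K - 2 * b2)) => n; have /andP[? ?] := bound n _ Dp; lra.
Qed.

(** The intervals obtained from [v1] and [v2] together cover the whole one, so [x] can be pulled
    back inside it again and again, and each map halves the error. *)
Lemma proj_gasket_approx : exists K : R, forall n x, 2 * b1 <= x <= 2 * b2 ->
  exists2 q, D q & `|proj q - x| <= K * (1 / 2) ^+ n.
Proof.
move: b10 b02 => b10' b02'.
have [[q0 Dq0] _ _] := hD.
exists (2 * b2 - 2 * b1); elim=> [|n IH] x xI.
  exists q0 => //; have /andP[? ?] := proj_gasket_sub Dq0; move/andP: xI => [? ?].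
  by rewrite expr0 mulr1 ler_norml; apply/andP; split; lra.
have [x1|x1] := leP x (b1 + b2).
  have /IH[q Dq qx] : 2 * b1 <= 2 * (x - b1) <= 2 * b2.
    by move/andP: xI => [? ?]; apply/andP; split; lra.
  exists (half_map v1 q); first by apply/gasket_half_mapP; exists q => //; right; left.
  rewrite proj_half_map proj_v1 exprS.
  by move: qx; rewrite !ler_norml => /andP[? ?]; apply/andP; split; lra.
have /IH[q Dq qx] : 2 * b1 <= 2 * (x - b2) <= 2 * b2.
  by move/andP: xI => [? ?]; apply/andP; split; lra.
exists (half_map v2 q); first by apply/gasket_half_mapP; exists q => //; right; right.
rewrite proj_half_map proj_v2 exprS.
by move: qx; rewrite !ler_norml => /andP[? ?]; apply/andP; split; lra.
Qed.

Lemma continuous_slope_proj : continuous (slope_proj theta : R * R -> R).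
Proof.
move=> p; apply: cvgB; first exact: cvg_snd.
by apply: cvgM; [exact: cvg_fst|exact: cvg_cst].
Qed.

(** The image of [D] is compact, hence closed, and [proj_gasket_approx] makes it dense in the
    interval. *)
Lemma proj_gasket_surj x : 2 * b1 <= x <= 2 * b2 -> exists2 q, D q & proj q = x.
Proof.
have [_ cD _] := hD; have [K Kx] := proj_gasket_approx.
have clD : closed (proj @` D).
  apply: compact_closed => //; apply: continuous_compact => //.
  exact/continuous_subspaceT/continuous_slope_proj.
move=> xI; have [|q Dq] := clD x; last by exists q.
move=> B /nbhs_ballP[e /= e0 eB].
have [n ne] : exists n, K * (1 / 2) ^+ n < e.
  apply: contrapT => /forallNP ne; suff : e <= 0 by rewrite leNgt e0.
  by apply: (@le0_of_geometric _ K) => n; rewrite leNgt; apply/negP.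
have [q Dq qx] := Kx n x xI.
exists (proj q); split; first by exists q.
by apply: eB; rewrite /ball/= distrC; apply: le_lt_trans qx ne.
Qed.

(** The slice at [a] is the union of half-size copies of the slices at [2 * (a - b_i)], which is the
    recursion of [hits]. At level [0] each coordinate varies by at most twice the bound on [D],
    hence the factor [4]. *)
Lemma slice_covered : exists2 M : R, 0 < M &
  forall n a, Defs.covered_by (slice a) (M * (1 / 2) ^+ n) (hits b0 b1 b2 n a).
Proof.
have [M M0 DM] := gasket_bounded; exists (4 * M); first by rewrite mulr_gt0.
elim=> [|n IH] a /=.
  have [aI|/negP aI] := boolP (2 * b1 <= a <= 2 * b2).
    exists (fun=> D); split; last by move=> p [_ Dp]; exists ord0.
    move=> _ p q /DM[p1 p2] /DM[q1 q2]; apply: le_trans (euclid_dist_le _ _) _.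
    rewrite expr0 mulr1; have := ler_normB p.1 q.1; have := ler_normB p.2 q.2; lra.
  exists (fun=> set0); split; first by move=> ? ? ? [].
  move=> p [/slope_lineP pa Dp].
  by case: aI; rewrite -pa; exact: proj_gasket_sub.
have -> : 4 * M * (1 / 2) ^+ n.+1 = (4 * M * (1 / 2) ^+ n) / 2 by rewrite exprS; field.
apply: covered_by_le (lexx _) (covered_byU (covered_byU
  (covered_by_half v0 (IH (2 * (a - b0)))) (covered_by_half v1 (IH (2 * (a - b1)))))
  (covered_by_half v2 (IH (2 * (a - b2))))).
move=> p [/slope_lineP pa /gasket_half_mapP[q Dq [pE|[pE|pE]]]];
  move: pa; rewrite pE proj_half_map ?proj_v0 ?proj_v1 ?proj_v2 => pa.
- by left; left; exists q => //; split=> //; apply/slope_lineP; lra.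
- by left; right; exists q => //; split=> //; apply/slope_lineP; lra.
- by right; exists q => //; split=> //; apply/slope_lineP; lra.
Qed.

(* The composition of [n] of the three maps sends [q] to [lattice_map n c q], where
   the binary digits of [c] record the positions of the second and of the third map. *)
Definition lattice_map (n : nat) (c : nat * nat) q : R * R :=
  ((1 / 2) ^+ n * (q.1 + c.1%:R + c.2%:R / 2),
   (1 / 2) ^+ n * (q.2 + Num.sqrt 3 / 2 * c.2%:R)).

(** Surjectivity of the projection puts a point of the slice in every triangle that [hits] counts.
    Codes turn the count of words into a count of distinct lattice positions. *)
Lemma slice_codes n a : exists s : seq (nat * nat),
  [/\ uniq s, size s = hits b0 b1 b2 n a &
    forall c, c \in s -> [/\ (c.1 < 2 ^ n)%N, (c.2 < 2 ^ n)%N &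
      exists2 q, D q & slice a (lattice_map n c q)]].
Proof.
elim: n a => [|n IH] a /=.
  have [aI|aI] := boolP (2 * b1 <= a <= 2 * b2); last by exists [::].
  exists [:: (0, 0)]%N; split=> // c; rewrite inE => /eqP->; split=> //.
  have [q Dq qa] := proj_gasket_surj aI; exists q => //.
  have -> : lattice_map 0 (0%N, 0%N) q = q.
    by case: q {Dq qa} => q1 q2; rewrite /lattice_map /= expr0; congr (_, _); field.
  by split=> //; apply/slope_lineP.
have [s0 [us0 ss0 Ds0]] := IH (2 * (a - b0)).
have [s1 [us1 ss1 Ds1]] := IH (2 * (a - b1)).
have [s2 [us2 ss2 Ds2]] := IH (2 * (a - b2)).
pose f1 (c : nat * nat) := ((c.1 + 2 ^ n)%N, c.2).
pose f2 (c : nat * nat) := (c.1, (c.2 + 2 ^ n)%N).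
exists ((s0 ++ map f1 s1) ++ map f2 s2).
have lt2 k : (k < 2 ^ n -> k < 2 ^ n.+1)%N by rewrite expnS; lia.
have lt2' k : (k < 2 ^ n -> k + 2 ^ n < 2 ^ n.+1)%N by rewrite expnS; lia.
have pow2_neq0 : (2 ^ n)%:R != 0 :> R by rewrite pnatr_eq0 -lt0n expn_gt0.
have pow2 : (1 / 2) ^+ n = 1 / (2 ^ n)%:R :> R by rewrite natrX expr_div_n expr1n.
split.
(* The outermost map contributes the digit of weight [2 ^ n], and all entries of [s0], [s1], [s2]
   are below it, so the three lists are disjoint. *)
- rewrite cat_uniq cat_uniq us0 !map_inj_uniq ?us1 ?us2 ?andbT /=; last 2 first.
  + by move=> [x1 x2] [y1 y2] [] ? ?; congr (_, _); lia.
  + by move=> [x1 x2] [y1 y2] [] ? ?; congr (_, _); lia.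
  apply/andP; split.
    apply/hasPn => _ /mapP[c cs ->]; apply/negP => /Ds0[/=]; lia.
  apply/hasPn => _ /mapP[c cs ->]; have [c1 c2 _] := Ds2 _ cs.
  rewrite mem_cat; apply/negP => /orP[/Ds0[/=]|/mapP[c' cs' [e1 _]]]; first by lia.
  by move: c1; rewrite e1 ltnNge leq_addl.
- by rewrite !size_cat !size_map ss0 ss1 ss2.
move=> c; rewrite !mem_cat -orbA => /or3P[/Ds0|/mapP[c' /Ds1 c's ->]|/mapP[c' /Ds2 c's ->]].
- move=> [c1 c2 [q Dq [/slope_lineP qa Dl]]]; split; [exact: lt2|exact: lt2|].
  exists q => //; have -> : lattice_map n.+1 c q = half_map v0 (lattice_map n c q).
    by rewrite /lattice_map /half_map /v0 /= exprS; congr (_, _); field.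
  split; first by apply/slope_lineP; rewrite proj_half_map proj_v0 qa; field.
  by apply/gasket_half_mapP; eexists; [exact: Dl|left].
- have [c1 c2 [q Dq [/slope_lineP qa Dl]]] := c's; split; [exact: lt2'|exact: lt2|].
  exists q => //; have -> : lattice_map n.+1 (f1 c') q = half_map v1 (lattice_map n c' q).
    rewrite /lattice_map /half_map /v1 /f1 /= exprS natrD pow2; by congr (_, _); field.
  split; first by apply/slope_lineP; rewrite proj_half_map proj_v1 qa; field.
  by apply/gasket_half_mapP; eexists; [exact: Dl|right; left].
- have [c1 c2 [q Dq [/slope_lineP qa Dl]]] := c's; split; [exact: lt2|exact: lt2'|].
  exists q => //; have -> : lattice_map n.+1 (f2 c') q = half_map v2 (lattice_map n c' q).
    rewrite /lattice_map /half_map /v2 /f2 /= exprS natrD pow2; by congr (_, _); field.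
  split; first by apply/slope_lineP; rewrite proj_half_map proj_v2 qa; field.
  by apply/gasket_half_mapP; eexists; [exact: Dl|right; right].
Qed.

Lemma eq_of_modn_near (L x y : nat) :
  (x < y + L)%N -> (y < x + L)%N -> (x %% L = y %% L)%N -> x = y.
Proof.
wlog xy : x y / (x <= y)%N.
  move=> H h1 h2 e; have [xy|xy] := leqP x y; first exact: H.
  by apply/esym/H => //; exact: ltnW.
move=> _ yx /eqP; rewrite eq_sym eqn_mod_dvd// => /dvdnP[k yk].
by case: k yk => [|k]; rewrite ?mulSn; lia.
Qed.

(** Codes with points in a common covering set differ by less than [L] in each entry. The covering
    set and the two residues modulo [L] therefore determine the code, hence the factor [L * L]. *)
Lemma hits_le_cover : exists L : nat, forall n a k,
  Defs.covered_by (slice a) ((1 / 2) ^+ n) k -> (hits b0 b1 b2 n a <= k * (L * L))%N.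
Proof.
have [M M0 DM] := gasket_bounded.
pose L := (Num.truncn (4 * (1 + 2 * M))).+1.
have L_gt : 4 * (1 + 2 * M) < L%:R by exact: truncnS_gt.
exists L => n a k [U [Ud aU]].
have [s [us <- Ds]] := slice_codes n a.
(* The value [None] is a default for codes outside [s], since ['I_k] may be empty. *)
have /choice[F FP] : forall c, exists i : option 'I_k, c \in s ->
    exists2 j, i = Some j & exists2 q, D q & U j (lattice_map n c q).
  move=> c; have [cs|cs] := boolP (c \in s); last by exists None.
  have [_ _ [q Dq /aU[j _ Uj]]] := Ds _ cs.
  by exists (Some j) => _; exists j => //; exists q.
have L0 : (0 < L)%N by [].
pose G (c : nat * nat) := (F c, Ordinal (ltn_pmod c.1 L0), Ordinal (ltn_pmod c.2 L0)).
pose T := [seq (Some z.1, z.2.1, z.2.2) | z <- enum {: 'I_k * ('I_L * 'I_L)}].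
have <- : size T = (k * (L * L))%N.
  by rewrite size_map -cardE !card_prod !card_ord.
rewrite -(size_map G); apply: uniq_leq_size; last first.
  move=> _ /mapP[c cs ->]; have [j Fj _] := FP c cs.
  apply/mapP; exists (j, (Ordinal (ltn_pmod c.1 L0), Ordinal (ltn_pmod c.2 L0))).
    by rewrite mem_enum.
  by rewrite /G Fj.
rewrite map_inj_in_uniq// => c d cs ds.
have [j Fj [q Dq Uq]] := FP c cs; have [j' Fj' [q' Dq' Uq']] := FP d ds.
rewrite /G Fj Fj' => -[jj' e1 e2].
rewrite -{j' Fj'}jj' in Uq'.
have [q1 q2] := DM _ Dq; have [q1' q2'] := DM _ Dq'.
have p0 : 0 < (1 / 2) ^+ n :> R by rewrite exprn_gt0.
have near_le (x y : R) : `|(1 / 2) ^+ n * x - (1 / 2) ^+ n * y| <= (1 / 2) ^+ n -> `|x - y| <= 1.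
  by rewrite -mulrBr normrM (gtr0_norm p0) -[X in _ <= X]mulr1 ler_pM2l.
have /= /near_le near1 := le_trans (euclid_dist_ge1 _ _) (Ud _ _ _ Uq Uq').
have /= /near_le near2 := le_trans (euclid_dist_ge2 _ _) (Ud _ _ _ Uq Uq').
have sqrt3 : 1 <= Num.sqrt 3 :> R by rewrite -[leLHS]sqrtr1 ler_wsqrtr// ler1n.
(* After rescaling, the points are within [1] in each coordinate and the points of [D] account for
   [2 * M]. The second coordinate thus controls [c.2 - d.2], and half of that bound enters the one
   for [c.1 - d.1]. *)
have c2d2 : `|c.2%:R - d.2%:R : R| <= 2 * (1 + 2 * M).
  apply: (@le_trans _ _ (`|Num.sqrt 3 * (c.2%:R - d.2%:R)|)).
    by rewrite normrM ler_peMl// ger0_norm ?sqrtr_ge0.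
  by move: near2 q2 q2'; rewrite !ler_norml => /andP[? ?] /andP[? ?] /andP[? ?]; apply/andP; split; lra.
have c1d1 : `|c.1%:R - d.1%:R : R| <= 2 * (1 + 2 * M).
  by move: near1 c2d2 q1 q1'; rewrite !ler_norml =>
    /andP[? ?] /andP[? ?] /andP[? ?] /andP[? ?]; apply/andP; split; lra.
have eq_of_near (x y : nat) : `|x%:R - y%:R : R| <= 2 * (1 + 2 * M) -> (x %% L = y %% L)%N -> x = y.
  rewrite ler_norml => /andP[xy1 xy2].
  by apply: eq_of_modn_near; rewrite -(ltr_nat R) natrD; lra.
by rewrite [c]surjective_pairing [d]surjective_pairing (eq_of_near _ _ c1d1 e1) (eq_of_near _ _ c2d2 e2).
Qed.

End gasket_slices.

(** * Balls and covers *)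

Section projected_measure.
Context {R : realType}.
Implicit Types (theta a : R).

(** As [3 * theta < pi], the sine of [3 * theta] is positive; it equals [sin theta * (3 * cos theta
    ^+ 2 - sin theta ^+ 2)]. *)
Lemma tan_lt_sqrt3 theta : 0 < theta < pi / 3 -> 0 < tan theta < Num.sqrt 3.
Proof.
move=> /andP[th0 th1]; have pi0 := pi_gt0 R.
have sin_gt0 : 0 < sin theta by apply: sin_gt0_pi; apply/andP; split; lra.
have cos_gt0 : 0 < cos theta by apply: cos_gt0_pihalf; apply/andP; split; lra.
have tan_gt0 : 0 < tan theta by rewrite divr_gt0.
rewrite tan_gt0 /=.
have sin3 : 0 < sin (theta *+ 2 + theta).
  by apply: sin_gt0_pi; rewrite mulr2n; apply/andP; split; lra.
have sin2E : sin theta ^+ 2 = 1 - cos theta ^+ 2 by rewrite -(cos2Dsin2 theta) addrAC subrr add0r.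
have {sin3} sin2 : sin theta ^+ 2 < 3 * cos theta ^+ 2.
  suff : 0 < sin theta * (3 * cos theta ^+ 2 - sin theta ^+ 2) by rewrite pmulr_rgt0// subr_gt0.
  move: sin3; rewrite sinD sin_mulr2n cos_mulr2n sin2E => /lt_le_trans; apply.
  by rewrite le_eqVlt; apply/orP; left; apply/eqP; ring.
rewrite -(ger0_norm (ltW tan_gt0)) -sqrtr_sqr ltr_sqrt// /tan expr_div_n.
by rewrite ltr_pdivrMr// exprn_gt0.
Qed.

Lemma measurable_slope_proj theta :
  @measurable_fun _ _ (measurableTypeR R * measurableTypeR R)%type (measurableTypeR R)
    setT (slope_proj theta).
Proof.
apply: measurable_funB; first exact: measurable_snd.
by apply: measurable_funM; [exact: measurable_fst|exact: measurable_cst].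
Qed.

Variables (D : set (R * R)) (hD : is_gasket D).
Variables (nu : probability (measurableTypeR R * measurableTypeR R)%type R).
Hypothesis hnu : is_gasket_measure nu.
Variables (theta a : R) (htheta : 0 < theta < pi / 3).

Local Notation slice := (slope_line theta a `&` D).
Local Notation b1 := (- (tan theta / 2)).
Local Notation b2 := ((Num.sqrt 3 - tan theta) / 4).

Let X : {mfun (measurableTypeR R * measurableTypeR R)%type >-> measurableTypeR R} :=
  @mfun_Sub _ _ (measurableTypeR R * measurableTypeR R)%type (measurableTypeR R)
    (slope_proj theta) (mem_set (measurable_slope_proj theta)).

Let mu : probability (measurableTypeR R) R := distribution nu X.

Let P (A : set R) : R := fine (mu A).

(** The projection intertwines each [gasket_map i] with a map [x => x / 2 + b_i], so the
    self-similarity of [nu] descends to the line. *)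
Lemma slope_proj_self_similar (A : set R) : measurable A ->
  P A = (P ((fun x => x / 2 + 0) @^-1` A) + P ((fun x => x / 2 + b1) @^-1` A) +
         P ((fun x => x / 2 + b2) @^-1` A)) / 3.
Proof.
move=> mA.
have mproj (B : set R) : measurable B ->
    measurable (slope_proj theta @^-1` B : set (measurableTypeR R * measurableTypeR R)).
  by move=> mB; rewrite -[X in measurable X]setTI; exact: measurable_slope_proj.
have mhalf (b : R) : measurable ((fun x => x / 2 + b) @^-1` A : set R).
  rewrite -[X in measurable X]setTI.
  suff : measurable_fun setT (fun x : measurableTypeR R => x / 2 + b : measurableTypeR R) by exact.
  by apply: measurable_funD => //; apply: measurable_funM.
have PE (B : set R) : measurable B -> nu (slope_proj theta @^-1` B) = (P B)%:E.
  by move=> mB; rewrite /P fineK// fin_num_measure//.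
apply: EFin_inj; rewrite -PE// (hnu (mproj _ mA)) !big_ord_recl big_ord0 /pushforward.
have pre (f : R * R -> R * R) (b : R) :
    (forall p, slope_proj theta (f p) = slope_proj theta p / 2 + b) ->
    f @^-1` (slope_proj theta @^-1` A) = slope_proj theta @^-1` ((fun x => x / 2 + b) @^-1` A).
  by move=> fE; apply/seteqP; split=> p /=; rewrite fE.
rewrite (pre _ 0); last by move=> p; rewrite /slope_proj /gasket_map /=; field.
rewrite (pre _ b1); last by move=> p; rewrite /slope_proj /gasket_map /=; field.
rewrite (pre _ b2); last by move=> p; rewrite /slope_proj /gasket_map /=; field.
rewrite !PE//.
by rewrite -!EFinM -!EFinD; congr (_%:E); field.
Qed.

Let t_gt0 : 0 < tan theta. Proof. by have /andP[] := tan_lt_sqrt3 htheta. Qed.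
Let t_lt : tan theta < Num.sqrt 3. Proof. by have /andP[] := tan_lt_sqrt3 htheta. Qed.

Hypothesis ha : (slope_proj theta @` D) a.

Let b10 : b1 < 0. Proof. by move: t_gt0 => ?; lra. Qed.
Let b02 : 0 < b2. Proof. by move: t_lt => ?; lra. Qed.

Let aI : 2 * b1 <= a <= 2 * b2.
Proof. by case: ha => p Dp <-; exact: proj_gasket_sub hD t_gt0 t_lt p Dp. Qed.

Lemma pow_half_le (x y : R) : 0 < x -> exists k : nat, y * (1 / 2) ^+ k <= x.
Proof.
move=> x0; have [n nx] := @exists_pow2_gt R y x x0; exists n.
by rewrite expr_div_n expr1n mulrA mulr1 ler_pdivrMr ?exprn_gt0// mulrC ltW.
Qed.

Lemma cover_number_slice (r : R) : 0 < r ->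
  exists k, [/\ Defs.covered_by slice r k, forall m, Defs.covered_by slice r m -> (k <= m)%N,
                cover_number slice r = k%:R%:E & (0 < k)%N].
Proof.
move=> r0; have [M M0 cov] := slice_covered hD t_gt0 t_lt.
have [n nr] := pow_half_le M r0.
have /cover_number_min[k [k1 k2 k3]] := covered_by_le (@subset_refl _ slice) nr (cov n a).
(* The slice is non-empty because [a] lies in the projection of [D], so the empty family does not
   cover it. *)
exists k; split=> //; rewrite lt0n; apply/negP => /eqP k0.
have [p Dp pa] := ha; move: k1; rewrite k0 => -[U [_ sU]].
have [[]//] : (\bigcup_i U i) p by apply: sU; split=> //; apply/slope_lineP.
Qed.

Lemma ball_cover_comparable : exists C1 C2 : R, [/\ 0 < C1, 0 < C2 &
  \forall r \near 0^'+, forall n, (1 / 2) ^+ n.+1 < r <= (1 / 2) ^+ n ->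
    C1 * (1 / 3) ^+ n * fine (cover_number slice r) <= P (ball a r) <=
    C2 * (3 * n + 1)%:R * (1 / 3) ^+ n * fine (cover_number slice r)].
Proof.
have [M M0 cov] := slice_covered hD t_gt0 t_lt.
have [L hL] := hits_le_cover hD t_gt0 t_lt.
pose l := 2 * (b2 - b1) + 1.
have l0 : 0 < l by rewrite /l; move: b10 b02 => ? ?; lra.
pose c := Num.min (- b1) b2 / 2.
have c0 : 0 < c by rewrite divr_gt0// lt_min oppr_gt0 b10.
have c1 : 2 * c <= 0 - b1 by rewrite sub0r mulrC divfK// ge_min lexx.
have c2 : 2 * c <= b2 - 0 by rewrite subr0 mulrC divfK// ge_min lexx orbT.
have [k1 k1M] := pow_half_le M (ltr01 : 0 < 1 :> R).
have [k2 k2l] := pow_half_le l (ltr01 : 0 < 1 :> R).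
have [k3 k3c] := pow_half_le 1 c0; rewrite mul1r in k3c.
have mB r : measurable (ball a r : set (measurableTypeR R)).
  exact: measurable_ball.
have P_mono r s : r <= s -> P (ball a r) <= P (ball a s).
  move=> rs; rewrite /P fine_le ?fin_num_measure// le_measure ?inE//.
  exact: le_ball.
have half_gt0 k : 0 < (1 / 2) ^+ k :> R by rewrite exprn_gt0.
have third_gt0 k : 0 < (1 / 3) ^+ k :> R by rewrite exprn_gt0.
have half_le j k : (j <= k)%N -> (1 / 2) ^+ k <= (1 / 2) ^+ j :> R.
  by move=> jk; apply: ler_wiXn2l => //; lra.
(* The powers of [3] are the price of moving [(k1 + k2).+1] levels finer for the lower bound and
   [k3] levels coarser for the upper one. The successor keeps the second constant positive if [L] is
   [0]. *)
exists ((1 / 3) ^+ (k1 + k2).+1), (3 ^+ k3 * (L * L).+1%:R); split=> //.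
near=> r => n /andP[rn1 rn2].
have r0 : 0 < r by near: r; exact: nbhs_right_gt.
have rk3 : r < (1 / 2) ^+ k3 by near: r; apply: nbhs_right_lt.
have [k [kr kmin -> k0]] := cover_number_slice r0 => /=.
apply/andP; split.
  (* At this level both the covering diameter [M * 2 ^ -m] and the radius [l * 2 ^ -m] are at most
     [r]. *)
  pose m := (n.+1 + (k1 + k2))%N.
  have scale x j : x * (1 / 2) ^+ j <= 1 -> (j <= k1 + k2)%N -> 0 < x -> x * (1 / 2) ^+ m <= r.
    move=> xj jk x0; apply: ltW; apply: le_lt_trans rn1.
    rewrite exprD mulrCA -[leRHS]mulr1 ler_pM2l//.
    by apply: le_trans xj; rewrite ler_pM2l// half_le.
  have Mr := scale _ _ k1M (leq_addr _ _) M0.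
  have lr := scale _ _ k2l (leq_addl _ _) l0.
  have km : (k <= hits 0 b1 b2 m a)%N.
    by apply: kmin; apply: covered_by_le (subset_refl _) Mr (cov m a).
  apply: le_trans (P_mono _ _ lr).
  have hl : 2 * (b2 - b1) < l by rewrite ltrDl.
  apply: le_trans (@ball_ge_hits R mu 0 b1 b2 b10 b02 slope_proj_self_similar l hl m a).
  by rewrite -exprD addnC addnS -addSn ler_pM2l// ler_nat.
(* For [r] below [2 ^ -k3] the subtraction [n - k3] is exact. At level [n - k3] the radius
   [c * 2 ^ -m] reaches [r], and a cover at scale [r] is also one at scale [2 ^ -m]. *)
have k3n : (k3 <= n)%N.
  rewrite leqNgt; apply/negP => /half_le; rewrite leNgt => /negP; apply.
  exact: lt_trans rn1 rk3.
pose m := (n - k3)%N.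
have rm : r <= (1 / 2) ^+ m by apply: le_trans rn2 (half_le _ _ (leq_subr _ _)).
have rc : r <= c * (1 / 2) ^+ m.
  apply: le_trans rn2 _; rewrite -(subnKC k3n) exprD -/m.
  by rewrite ler_pM2r.
have hk : (hits 0 b1 b2 m a <= k * (L * L))%N.
  by apply: hL; apply: covered_by_le (subset_refl _) rm kr.
apply: le_trans (P_mono _ _ rc) _.
apply: le_trans (@ball_le_hits R mu 0 b1 b2 b10 b02 slope_proj_self_similar c c0 c1 c2 m a aI) _.
have -> : (1 / 3) ^+ n = (1 / 3) ^+ k3 * (1 / 3) ^+ m :> R by rewrite -exprD subnKC.
have -> : 3 ^+ k3 * (L * L).+1%:R * (3 * n + 1)%:R * ((1 / 3) ^+ k3 * (1 / 3) ^+ m) * k%:R =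
    (3 * n + 1)%:R * (1 / 3) ^+ m * (k * (L * L).+1)%:R * (3 * (1 / 3)) ^+ k3 :> R.
  by rewrite (exprMn k3 3 (1 / 3)) (natrM _ k); ring.
have -> : 3 * (1 / 3) = 1 :> R by field.
rewrite expr1n mulr1; apply: ler_pM; rewrite ?mulr_ge0//.
  by rewrite ler_pM2r// ler_nat leq_add2r leq_mul2l leq_subr orbT.
by rewrite ler_nat; apply: leq_trans hk _; rewrite leq_mul2l leqnSn orbT.
Unshelve. all: by end_near. Qed.

End projected_measure.

(** * The two dimension formulas *)

Theorem proposition1p2 (R : realType) (Delta : set (R * R))
    (nu : probability (measurableTypeR R * measurableTypeR R)%type R)
    (hDelta : is_gasket Delta) (hnu : is_gasket_measure nu)
    (theta : R) (htheta : 0 < theta < pi / 3)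
    (a : R) (ha : (slope_proj theta @` Delta) a) :
  let nu_theta : set R -> \bar R :=
    pushforward nu (slope_proj theta : _ -> measurableTypeR R) in
  let E : set (R * R) := slope_line theta a `&` Delta in
  let s : R := ln 3 / ln 2 in
  (lower_local_dim nu_theta a + upper_box_dim E = s%:E)%E /\
  (upper_local_dim nu_theta a + lower_box_dim E = s%:E)%E.
Proof.
move=> nu_theta E s.
have [C1 [C2 [C10 C20 comparable]]] := ball_cover_comparable hDelta hnu htheta ha.
rewrite -/E in comparable.
pose c r := fine (cover_number E r).
pose v r := fine (nu_theta (ball a r)).
have c1 : \forall r \near 0^'+, 1 <= c r.
  near=> r; have r0 : 0 < r by near: r; exact: nbhs_right_gt.
  have [k [_ _ ck k0]] := cover_number_slice hDelta htheta ha r0.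
  by rewrite /c ck /= ler1n.
have sum_cvg := log_ratio_sum C10 C20 c1 comparable.
have mball r : measurable (slope_proj theta @^-1` ball a r : set (measurableTypeR R * measurableTypeR R)).
  rewrite -[X in measurable X]setTI; apply: measurable_slope_proj => //.
  exact: measurable_ball.
have vE r : nu_theta (ball a r) = (v r)%:E.
  by rewrite /v fineK// /nu_theta /pushforward fin_num_measure.
(* Positivity, from the lower bound in [comparable], keeps the extended logarithm finite; the bound
   by [1] makes the ratio non-negative. *)
have v01 : \forall r \near 0^'+, 0 < v r <= 1.
  near=> r; have r0 : 0 < r by near: r; exact: nbhs_right_gt.
  have r1 : r <= 1 by near: r; exact: nbhs_right_le.
  have [n nr] := @dyadic_scale R r (introT andP (conj r0 r1)).
  apply/andP; split; last by rewrite -lee_fin -vE; exact: probability_le1.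
  have /(_ n nr)/andP[+ _] : forall n, (1 / 2) ^+ n.+1 < r <= (1 / 2) ^+ n ->
    C1 * (1 / 3) ^+ n * c r <= v r <= C2 * (3 * n + 1)%:R * (1 / 3) ^+ n * c r.
    by near: r.
  apply: lt_le_trans; rewrite !mulr_gt0 ?exprn_gt0//.
  by apply: (@lt_le_trans _ _ 1) => //; near: r.
have lnr : \forall r \near 0^'+, ln r < 0 :> R.
  near=> r; apply: ln_lt0; apply/andP; split.
    by near: r; exact: nbhs_right_gt.
  by near: r; exact: nbhs_right_lt.
pose f r := ln (v r) / ln r.
pose g r := ln (c r) / - ln r.
have ballE : \forall r \near 0^'+, log_ratio_ball nu_theta a r = (f r)%:E.
  near=> r; have /andP[v0 _] : 0 < v r <= 1 by near: r.
  have lr : ln r < 0 by near: r.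
  by rewrite /log_ratio_ball vE lne_EFin// inver lt_eqF// -EFinM.
have coverE : \forall r \near 0^'+, log_ratio_cover E r = (g r)%:E.
  near=> r; have r0 : 0 < r by near: r; exact: nbhs_right_gt.
  have lr : ln r < 0 by near: r.
  have [k [_ _ ck k0]] := cover_number_slice hDelta htheta ha r0.
  by rewrite /log_ratio_cover /g /c ck lne_EFin ?ltr0n// inver oppr_eq0 lt_eqF.
have f0 : \forall r \near 0^'+, 0 <= f r.
  near=> r; have /andP[v0 v1] : 0 < v r <= 1 by near: r.
  have lr : ln r < 0 by near: r.
  by rewrite /f mulr_le0// ?ln_le0// invr_le0 ltW.
have g0 : \forall r \near 0^'+, 0 <= g r.
  near=> r; have cr : 1 <= c r by near: r.
  have lr : ln r < 0 by near: r.
  by rewrite /g divr_ge0 ?ln_ge0// oppr_ge0 ltW.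
split.
  exact: limf_einf_add_esup ballE coverE f0 g0 sum_cvg.
(* The same lemma with the two ratios exchanged. *)
rewrite addeC; apply: limf_einf_add_esup coverE ballE g0 f0 _ => e e0.
by apply: filterS (sum_cvg e e0) => r; rewrite [g r + _]addrC.
Unshelve. all: by end_near. Qed.
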